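(* For every pair of integers $k\geq 3$ and $t\geq 3$ there exists a connected graph $H_n$ on $n = k\cdot t$ vertices with minimum degree $\delta(H_n) = \frac{n-k}{k}$ and exactly $k-1$ cut edges.
   Context: All graphs are finite, simple and undirected; a cut edge is an edge whose removal disconnects the graph. *)

(* Defs.v *)
From mathcomp Require Import all_boot all_order all_algebra.

Set Implicit Arguments.
Unset Strict Implicit.
Unset Printing Implicit Defensive.

Record simple_graph (T : finType) := SimpleGraph {
  adj :> rel T;
  adj_sym : symmetric adj;
  adj_irr : irreflexive adj }.

Section Graph.
Variables (T : finType) (G : simple_graph T).
Implicit Types (x y : T) (e : {set T}).

Definition edges : {set {set T}} :=
  [set e | [exists x, exists y, adj G x y && (e == [set x; y])]].

Definition connected : bool := [forall x, forall y, connect (adj G) x y].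

Definition degree x : nat := #|[set y | adj G x y]|.

(* The default #|T| exceeds every degree, so it only matters on the graph
   without vertices. *)
Definition min_degree : nat := \big[minn/#|T|]_x degree x.

Definition delete_rel e : rel T := fun x y => adj G x y && ([set x; y] != e).

Fact delete_rel_sym e : symmetric (delete_rel e).
Proof. by move=> x y; rewrite /delete_rel adj_sym setUC. Qed.

Fact delete_rel_irr e : irreflexive (delete_rel e).
Proof. by move=> x; rewrite /delete_rel adj_irr. Qed.

Definition delete_edge e : simple_graph T :=
  SimpleGraph (delete_rel_sym e) (delete_rel_irr e).

End Graph.

(* Meaningful for connected G: "removal disconnects" is read as "the graph
   obtained by removing e is not connected". *)
Definition cut_edges (T : finType) (G : simple_graph T) : {set {set T}} :=
  [set e in edges G | ~~ connected (delete_edge G e)].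

(* Main.v *)
Require Import Defs.
From mathcomp Require Import all_boot all_order all_algebra.

(** Glue a copy of the complete graph on [t] vertices, by one of its vertices,
    to each vertex of the star on [k] vertices; this is the rooted product of
    the two graphs. A vertex outside the star keeps its degree [t - 1], which is
    the least possible. Contracting all copies, or everything but one copy, is
    a retraction onto a factor, so the cut edges of the product are those of the
    star together with those of each copy. All [k - 1] edges of the star are
    pendant, hence cut edges, while for [t >= 3] every edge of the complete
    graph lies in a triangle, hence is not a cut edge. *)

Set Implicit Arguments.
Unset Strict Implicit.
Unset Printing Implicit Defensive.

Lemma connect_homo (T U : finType) (f : T -> U) (e : rel T) (e' : rel U) :
    {homo f : x y / e x y >-> connect e' x y} ->
  {homo f : x y / connect e x y >-> connect e' x y}.
Proof.
move=> f_homo x _ /connectP[p + ->]; elim: p x => [|y p IHp] x //=.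
by case/andP=> /f_homo/connect_trans fxy /IHp/fxy.
Qed.

Lemma imset_set2 (T U : finType) (f : T -> U) (x y : T) :
  f @: [set x; y] = [set f x; f y].
Proof. by rewrite imsetU1 imset_set1. Qed.

Section GraphTheory.
Variables (T : finType) (G : simple_graph T).
Implicit Types x y z u v : T.

Lemma adj_neq x y : adj G x y -> x != y.
Proof. by apply: contraTneq => ->; rewrite adj_irr. Qed.

Lemma connect_adj_sym : connect_sym (adj G).
Proof. exact/sym_connect_sym/adj_sym. Qed.

Lemma connectedP :
  reflect (forall x y, connect (adj G) x y) (connected G).
Proof. by apply: (iffP forallP) => conn x; apply/forallP/conn. Qed.

Lemma connected_hub z : (forall x, connect (adj G) x z) -> connected G.
Proof.
move=> to_z; apply/connectedP => x y; apply: connect_trans (to_z x) _.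
by rewrite connect_adj_sym.
Qed.

Lemma min_degree_attained x :
  (forall y, degree G x <= degree G y) -> min_degree G = degree G x.
Proof.
move=> x_min; rewrite /min_degree -minEnat; apply: Order.POrderTheory.le_anti.
rewrite Order.TotalTheory.bigmin_le /=.
by apply/Order.TotalTheory.bigmin_geP; split; first exact: max_card.
Qed.

End GraphTheory.

Section CutEdges.
Variables (T : finType) (G : simple_graph T).
Implicit Types x y z u v : T.

Lemma edgesP (e : {set T}) :
  reflect (exists x y, adj G x y /\ e = [set x; y]) (e \in edges G).
Proof.
rewrite inE; apply: (iffP existsP) => -[x].
  by case/existsP=> y /andP[xy /eqP->]; exists x, y.
by case=> y [xy ->]; exists x; apply/existsP; exists y; rewrite xy eqxx.
Qed.

Lemma adj_eq_set2 x y u v :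
  adj G u v -> [set x; y] = [set u; v] ->
  (x = u /\ y = v) \/ (x = v /\ y = u).
Proof.
move=> uv eq_xy_uv.
have xy : x != y.
  have := cards2 x y; rewrite eq_xy_uv cards2 (adj_neq uv).
  by case: (x != y).
have /set2P x_uv : x \in [set u; v] by rewrite -eq_xy_uv set21.
have /set2P y_uv : y \in [set u; v] by rewrite -eq_xy_uv set22.
by case: x_uv y_uv xy => -> [] ->; rewrite ?eqxx //; [left | right].
Qed.

Lemma mem_edges_set2 x y : ([set x; y] \in edges G) = adj G x y.
Proof.
apply/edgesP/idP => [[u [v [uv]]]|xy]; last by exists x, y.
by case/(adj_eq_set2 uv)=> -[-> ->]; rewrite // adj_sym.
Qed.

Lemma card_edge (e : {set T}) : e \in edges G -> #|e| = 2.
Proof. by case/edgesP=> x [y [xy ->]]; rewrite cards2 (adj_neq xy). Qed.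

Lemma mem_cut_edges x y : connected G ->
  ([set x; y] \in cut_edges G)
  = adj G x y && ~~ connect (delete_rel G [set x; y]) x y.
Proof.
move/connectedP=> Gconn; rewrite inE mem_edges_set2.
have [xy|//] /= := boolP (adj G x y); congr (~~ _).
set D := delete_edge G [set x; y].
apply/connectedP/idP => [Dconn|xyD u v]; first exact: (Dconn x y).
apply: connect_sub (Gconn u v) => {}u {}v uv.
have [eq_uv_xy|neq_uv_xy] := eqVneq [set u; v] [set x; y]; last first.
  by apply: connect1; rewrite /= /delete_rel uv.
by case: (adj_eq_set2 xy eq_uv_xy) => -[-> ->] //; rewrite (connect_adj_sym D).
Qed.

Lemma triangle_notin_cut_edges x y z :
  connected G -> adj G x z -> adj G z y -> [set x; y] \notin cut_edges G.
Proof.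
move=> Gconn xz zy; rewrite mem_cut_edges // negb_and negbK.
have [xy /=|//] := boolP (adj G x y).
apply: (connect_trans (y := z)); apply: connect1.
  rewrite /delete_rel xz; apply: contraTneq zy.
  by case/(adj_eq_set2 xy)=> -[xE ->]; rewrite ?xE adj_irr.
rewrite /delete_rel zy; apply: contraTneq xz.
by case/(adj_eq_set2 xy)=> -[-> yE]; rewrite ?yE adj_irr.
Qed.

Lemma pendant_in_cut_edges x y :
    connected G -> adj G x y -> (forall z, adj G x z -> z = y) ->
  [set x; y] \in cut_edges G.
Proof.
move=> Gconn xy x_pendant; rewrite mem_cut_edges // xy /=.
apply/negP=> /connectP[[_ yx|z p /andP[/andP[xz neq_e] _] _]].
  by rewrite yx adj_irr in xy.
by rewrite (x_pendant z xz) eqxx in neq_e.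
Qed.

End CutEdges.

(* [g] contracts the edges of [G] outside [f H], so it carries a path of [G]
   avoiding the edge [f e] to a path of [H] avoiding [e]. *)
Lemma mem_cut_edges_retract (T U : finType) (G : simple_graph T)
    (H : simple_graph U) (f : U -> T) (g : T -> U) (e : {set U}) :
    connected G -> cancel f g -> {homo f : x y / adj H x y >-> adj G x y} ->
    (forall u v, adj G u v ->
       g u = g v \/ exists x y, [/\ adj H x y, u = f x & v = f y]) ->
  e \in edges H -> (f @: e \in cut_edges G) = (e \in cut_edges H).
Proof.
move=> Gconn fK f_homo g_contr /edgesP[x [y [xy ->]]].
have f_inj := can_inj fK.
have Hconn : connected H.
  have g_walk : {homo g : u v / adj G u v >-> connect (adj H) u v}.
    move=> u v /g_contr[->|[u' [v' [uv -> ->]]]]; first exact: connect0.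
    by rewrite !fK connect1.
  apply/connectedP=> u v; rewrite -[u]fK -[v]fK.
  exact/(connect_homo g_walk)/connectedP.
rewrite imset_set2 !mem_cut_edges // xy f_homo //=; congr (~~ _).
set DG := delete_rel G _; set DH := delete_rel H _.
have f_walk : {homo f : u v / DH u v >-> connect DG u v}.
  move=> u v /andP[uv neq_e]; apply: connect1.
  rewrite /DG /delete_rel f_homo //.
  by rewrite -!imset_set2 (inj_eq (imset_inj f_inj)).
have g_walk : {homo g : u v / DG u v >-> connect DH u v}.
  move=> u v /andP[/g_contr[->|[u' [v' [uv -> ->]]]] neq_e].
    exact: connect0.
  rewrite !fK; apply: connect1; rewrite /DH /delete_rel uv.
  by rewrite -!imset_set2 (inj_eq (imset_inj f_inj)) in neq_e.
apply/idP/idP => [/(connect_homo g_walk)|/(connect_homo f_walk)//].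
by rewrite !fK.
Qed.

Section CompleteGraph.
Variable T : finType.
Implicit Types x y : T.

Definition complete_rel : rel T := fun x y => x != y.

Fact complete_sym : symmetric complete_rel.
Proof. by move=> x y; rewrite /complete_rel eq_sym. Qed.

Fact complete_irr : irreflexive complete_rel.
Proof. by move=> x; rewrite /complete_rel eqxx. Qed.

Definition complete_graph : simple_graph T :=
  SimpleGraph complete_sym complete_irr.

Lemma connected_complete_graph : connected complete_graph.
Proof.
apply/connectedP=> x y; have [->|xy] := eqVneq x y; first exact: connect0.
exact: connect1.
Qed.

Lemma degree_complete_graph x : degree complete_graph x = #|T|.-1.
Proof.
by rewrite -(cardsC1 x); apply: eq_card => y; rewrite !inE eq_sym.
Qed.

Lemma cut_edges_complete_graph : 2 < #|T| -> cut_edges complete_graph = set0.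
Proof.
move=> T_gt2; apply/setP=> e; rewrite in_set0; apply/negP=> e_cut.
have /setIdP[/edgesP[x [y [xy eE]]] _] := e_cut.
have [z] : exists z, z \in ~: [set x; y].
  apply/set0Pn; rewrite -card_gt0 cardsCs setCK cards2 subn_gt0.
  by apply: leq_trans T_gt2; rewrite !ltnS leq_b1.
rewrite !inE negb_or => /andP[zx zy]; move: e_cut; rewrite eE; apply/negP.
apply: (@triangle_notin_cut_edges _ _ _ _ z) => //.
  exact: connected_complete_graph.
by rewrite /= complete_sym.
Qed.

End CompleteGraph.

Section StarGraph.
Variables (T : finType) (c : T).
Implicit Types x y : T.

Definition star_rel : rel T := fun x y => (x != y) && ((x == c) || (y == c)).

Fact star_sym : symmetric star_rel.
Proof. by move=> x y; rewrite /star_rel eq_sym orbC. Qed.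

Fact star_irr : irreflexive star_rel.
Proof. by move=> x; rewrite /star_rel eqxx. Qed.

Definition star_graph : simple_graph T := SimpleGraph star_sym star_irr.

Lemma connected_star_graph : connected star_graph.
Proof.
apply: (@connected_hub _ _ c) => x; have [->|xc] := eqVneq x c.
  exact: connect0.
by apply: connect1; rewrite /= /star_rel xc eqxx orbT.
Qed.

Lemma cut_edges_star_graph :
  cut_edges star_graph = [set [set x; c] | x in [set~ c]].
Proof.
apply/setP=> e; apply/idP/imsetP => [/setIdP[/edgesP[x [y [xy ->]]] _]|[x]].
  case/andP: xy => + /orP[]/eqP xyE; rewrite xyE => xy.
    by exists y; rewrite 1?setUC // !inE eq_sym.
  by exists x; rewrite // !inE.
rewrite in_setC1 => xc ->; apply: pendant_in_cut_edges.
- exact: connected_star_graph.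
- by rewrite /= /star_rel xc eqxx orbT.
- by move=> y; rewrite /= /star_rel (negPf xc) => /andP[_ /eqP].
Qed.

Lemma card_cut_edges_star_graph : #|cut_edges star_graph| = #|T|.-1.
Proof.
rewrite cut_edges_star_graph card_in_imset ?cardsC1 // => x y.
rewrite !inE => xc _ eq_xy; have := set21 x c.
by rewrite eq_xy !inE (negPf xc) orbF => /eqP.
Qed.

End StarGraph.

Section RootedProduct.
Variables (I J : finType) (G : simple_graph I) (H : simple_graph J) (r : J).
Implicit Types (i j : I) (a b : J).

Definition rooted_product_rel : rel (I * J) := fun x y =>
  (x.1 == y.1) && adj H x.2 y.2 || [&& x.2 == r, y.2 == r & adj G x.1 y.1].

Fact rooted_product_sym : symmetric rooted_product_rel.
Proof.
move=> x y; rewrite /rooted_product_rel eq_sym (adj_sym H) (adj_sym G).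
by rewrite andbCA.
Qed.

Fact rooted_product_irr : irreflexive rooted_product_rel.
Proof. by move=> x; rewrite /rooted_product_rel !adj_irr !andbF. Qed.

Definition rooted_product : simple_graph (I * J)%type :=
  SimpleGraph rooted_product_sym rooted_product_irr.

Lemma adj_rooted_productP (x y : I * J) :
  reflect ((exists i a b, [/\ adj H a b, x = (i, a) & y = (i, b)])
           \/ (exists i j, [/\ adj G i j, x = (i, r) & y = (j, r)]))
          (adj rooted_product x y).
Proof.
case: x y => [i a] [j b]; rewrite /= /rooted_product_rel /=.
apply: (iffP orP) => -[].
- by case/andP=> /eqP-> ab; left; exists j, a, b.
- by case/and3P=> /eqP-> /eqP-> ij; right; exists i, j.
- by case=> l [c [d [cd [-> ->] [-> ->]]]]; left; rewrite eqxx.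
- by case=> l [m [lm [-> ->] [-> ->]]]; right; rewrite !eqxx.
Qed.

Lemma adj_rooted_product_copy i :
  {homo pair i : a b / adj H a b >-> adj rooted_product a b}.
Proof. by move=> a b ab; apply/adj_rooted_productP; left; exists i, a, b. Qed.

Lemma adj_rooted_product_base :
  {homo pair^~ r : i j / adj G i j >-> adj rooted_product i j}.
Proof. by move=> i j ij; apply/adj_rooted_productP; right; exists i, j. Qed.

Lemma connected_rooted_product :
  connected G -> connected H -> connected rooted_product.
Proof.
move=> /connectedP Gconn /connectedP Hconn.
have in_copy i a b : connect (adj rooted_product) (i, a) (i, b).
  apply: connect_homo (Hconn a b) => {}a {}b.
  by move/(adj_rooted_product_copy i)/connect1.
apply/connectedP=> -[i a] [j b]; apply: connect_trans (in_copy i a r) _.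
apply: connect_trans (in_copy j r b).
apply: (connect_homo (f := pair^~ r)) (Gconn i j) => {}i {}j.
by move/adj_rooted_product_base/connect1.
Qed.

Lemma neighbours_rooted_product i a :
  [set x | adj rooted_product (i, a) x]
  = pair i @: [set b | adj H a b]
    :|: (if a == r then pair^~ r @: [set j | adj G i j] else set0).
Proof.
apply/setP=> x; rewrite inE in_setU.
apply/adj_rooted_productP/orP => [[]|[]].
- by case=> l [c [b [cb [-> ->] ->]]]; left; rewrite imset_f ?inE.
- by case=> l [j [lj [-> ->] ->]]; right; rewrite eqxx imset_f ?inE.
- by case/imsetP=> b; rewrite inE => ab ->; left; exists i, a, b.
- case: eqP => [->|_]; last by rewrite in_set0.
  by case/imsetP=> j; rewrite inE => ij ->; right; exists i, j.
Qed.

Lemma degree_rooted_product i a :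
  degree rooted_product (i, a) = degree H a + (a == r) * degree G i.
Proof.
rewrite /degree neighbours_rooted_product.
have pair_inj : injective (pair i : J -> I * J) by move=> b c [].
case: (a == r); last by rewrite setU0 addn0 card_imset.
have pairr_inj : injective (pair^~ r : I -> I * J) by move=> j l [].
rewrite mul1n cardsU !card_imset //.
suff -> : pair i @: [set b | adj H a b] :&: pair^~ r @: [set j | adj G i j]
          = set0.
  by rewrite cards0 subn0.
apply/setP=> x; rewrite in_set0; apply/setIP=> -[/imsetP[b _ ->] /imsetP[j]].
by rewrite inE => ij [eq_ij _]; rewrite eq_ij adj_irr in ij.
Qed.

Lemma min_degree_rooted_product i a :
    a != r -> (forall b, degree H a <= degree H b) ->
  min_degree rooted_product = degree H a.
Proof.
move=> ar a_min; have deg_a : degree rooted_product (i, a) = degree H a.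
  by rewrite degree_rooted_product (negPf ar) addn0.
rewrite -deg_a; apply: min_degree_attained => -[j b].
by rewrite deg_a degree_rooted_product (leq_trans (a_min b)) ?leq_addr.
Qed.

Lemma edges_rooted_product :
  edges rooted_product
  = [set pair^~ r @: (e : {set I}) | e in edges G]
    :|: \bigcup_i [set pair i @: (e : {set J}) | e in edges H].
Proof.
apply/setP=> e; rewrite in_setU.
apply/edgesP/orP => [[x [y [xy ->]]]|[/imsetP[d]|/bigcupP[i _ /imsetP[d]]]].
- case/adj_rooted_productP: xy => [[i [a [b [ab -> ->]]]]|[i [j [ij -> ->]]]].
    right; apply/bigcupP; exists i => //.
    by rewrite -(imset_set2 (pair i)) imset_f ?mem_edges_set2.
  by left; rewrite -(imset_set2 (pair^~ r)) imset_f ?mem_edges_set2.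
- case/edgesP=> i [j [ij ->]] ->; exists (i, r), (j, r); split.
    exact: adj_rooted_product_base.
  by rewrite (imset_set2 (pair^~ r)).
- case/edgesP=> a [b [ab ->]] ->; exists (i, a), (i, b); split.
    exact: adj_rooted_product_copy.
  by rewrite (imset_set2 (pair i)).
Qed.

Lemma mem_cut_edges_base (e : {set I}) :
  connected rooted_product -> e \in edges G ->
  (pair^~ r @: e \in cut_edges rooted_product) = (e \in cut_edges G).
Proof.
move=> conn; apply: (mem_cut_edges_retract (g := fst)) => //.
  exact: adj_rooted_product_base.
move=> x y /adj_rooted_productP[[i [a [b [_ -> ->]]]]|]; first by left.
by case=> i [j [ij -> ->]]; right; exists i, j.
Qed.

Lemma mem_cut_edges_copy i (e : {set J}) :
  connected rooted_product -> e \in edges H ->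
  (pair i @: e \in cut_edges rooted_product) = (e \in cut_edges H).
Proof.
move=> conn; pose g (x : I * J) := if x.1 == i then x.2 else r.
apply: (mem_cut_edges_retract (g := g)) => //.
- by move=> a; rewrite /g eqxx.
- exact: adj_rooted_product_copy.
move=> x y /adj_rooted_productP[[j [a [b [ab -> ->]]]]|].
  have [<-|ji] := eqVneq j i; first by right; exists a, b.
  by left; rewrite /g /= (negPf ji).
by case=> j [l [_ -> ->]]; left; rewrite /g /= !if_same.
Qed.

Lemma cut_edges_rooted_product : connected G -> connected H ->
  cut_edges rooted_product
  = [set pair^~ r @: (e : {set I}) | e in cut_edges G]
    :|: \bigcup_i [set pair i @: (e : {set J}) | e in cut_edges H].
Proof.
move=> Gconn Hconn; have conn := connected_rooted_product Gconn Hconn.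
apply/setP=> e; rewrite in_setU; apply/idP/orP => [e_cut|].
  have /setIdP[+ _] := e_cut; rewrite edges_rooted_product in_setU.
  case/orP=> [/imsetP[d dG]|/bigcupP[i _ /imsetP[d dH]]] eE; [left|right].
    by rewrite eE imset_f // -mem_cut_edges_base -?eE.
  apply/bigcupP; exists i => //.
  by rewrite eE imset_f // -(mem_cut_edges_copy i) -?eE.
case=> [/imsetP[d d_cut ->]|/bigcupP[i _ /imsetP[d d_cut ->]]].
- by have /setIdP[dG _] := d_cut; rewrite mem_cut_edges_base.
- by have /setIdP[dH _] := d_cut; rewrite mem_cut_edges_copy.
Qed.

Lemma card_cut_edges_rooted_product : connected G -> connected H ->
  #|cut_edges rooted_product| = #|cut_edges G| + #|I| * #|cut_edges H|.
Proof.
move=> Gconn Hconn; rewrite cut_edges_rooted_product //.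
pose base := [set pair^~ r @: (e : {set I}) | e in cut_edges G].
pose copy i := [set pair i @: (e : {set J}) | e in cut_edges H].
have fst_base (e : {set I}) : fst @: (pair^~ r @: e) = e.
  by rewrite -imset_comp; apply: imset_id.
have fst_copy i e : e \in copy i -> fst @: e = [set i].
  case/imsetP=> d /setIdP[/edgesP[a [b [_ ->]]] _] ->.
  by rewrite !imset_set2 setUid.
have base_copy_disjoint : [disjoint base & \bigcup_i copy i].
  apply/pred0P=> e; apply/andP=> -[/imsetP[d /setIdP[/card_edge card_d _] ->]].
  case/bigcupP=> i _ /fst_copy; rewrite fst_base => dE.
  by rewrite dE cards1 in card_d.
have copies_disjoint i j : i != j -> [disjoint copy i & copy j].
  move=> ij; apply/pred0P=> e; apply/andP=> -[/fst_copy fst_i /fst_copy].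
  by rewrite fst_i => /set1_inj eq_ij; rewrite eq_ij eqxx in ij.
rewrite cardsU disjoint_setI0 // cards0 subn0 card_imset; last first.
  by apply: imset_inj => i j [].
congr (_ + _); rewrite -sum1_card partition_disjoint_bigcup //=.
rewrite -sum_nat_const; apply: eq_bigr => i _.
by rewrite sum1_card card_imset //; apply: imset_inj => a b [].
Qed.

End RootedProduct.

Theorem theorem3p2 (k t n : nat) (hk : 3 <= k) (ht : 3 <= t) (hn : n = k * t) :
  exists (T : finType) (H : simple_graph T),
    [/\ #|T| = n,
        connected H,
        ((min_degree H)%:R = (n%:R - k%:R) / k%:R :> rat)%R
      & #|cut_edges H| = k - 1].
Proof.
case: k t hk ht hn => [//|k] [//|t] _ ht ->.
pose S := star_graph (ord0 : 'I_k.+1); pose K := complete_graph 'I_t.+1.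
have Sconn : connected S := connected_star_graph _.
have Kconn : connected K := connected_complete_graph _.
have ord_max_neq0 : (ord_max : 'I_t.+1) != ord0 by rewrite -val_eqE -lt0n ltnW.
have min_degree_SK : min_degree (rooted_product S K ord0) = t.
  rewrite (min_degree_rooted_product _ ord0 ord_max_neq0).
    by rewrite degree_complete_graph card_ord.
  by move=> b; rewrite !degree_complete_graph.
exists ('I_k.+1 * 'I_t.+1)%type, (rooted_product S K ord0); split.
- by rewrite card_prod !card_ord.
- exact: connected_rooted_product.
- rewrite min_degree_SK mulnS GRing.natrD GRing.addrC GRing.addKr.
  by rewrite GRing.natrM GRing.mulrC GRing.mulKf // Num.Theory.pnatr_eq0.
- rewrite card_cut_edges_rooted_product // card_cut_edges_star_graph.
  by rewrite cut_edges_complete_graph ?cards0 ?muln0 ?addn0 ?card_ord ?subn1.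
Qed.
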